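(* Let $\lambda$ be a nonzero real number. For all $n,m\in \mathbb{N}$, \[ K_{n,\lambda}^{(m)} = \sum_{1\le k_1\le k_2 \le \cdots \le k_m \le n}\frac{(-1)^{k_1-1}}{k_1 k_2 \cdots k_{m}} \binom{\lambda-1}{k_1-1}, \] where the sum runs over all integer tuples $(k_1,\dots,k_m)$ with $1\le k_1\le\cdots\le k_m\le n$.
   Context: For real $x$ and integer $k\ge0$, $\binom{x}{k}=\frac{x(x-1)\cdots(x-k+1)}{k!}$. For a nonzero real $\mu$ and integer $m$, the degenerate polylogarithm is the power series $\mathrm{Li}_{m,\mu}(t)=\sum_{n=1}^\infty \frac{(-1)^{n-1}}{n^m}\binom{\mu-1}{n-1}t^n$ (equivalently $\sum_{n\ge1}\frac{(-\mu)^{n-1}(1)_{n,1/\mu}}{(n-1)!\,n^m}t^n$, where $(x)_{0,\mu}=1$, $(x)_{n,\mu}=x(x-\mu)\cdots(x-(n-1)\mu)$). For $m\ge1$, the numbers $K^{(m)}_{n,\lambda}$ ($n\ge1$) are defined by the formal power series identity \[ \frac{-1}{1-t}\mathrm{Li}_{m,-\lambda}\left(\frac{-t}{1-t}\right)=\sum_{n=1}^\infty K_{n,\lambda}^{(m)}\, t^n . \] *)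

(* Defs.v *)
From mathcomp Require Import all_boot all_order all_algebra.
From mathcomp Require Import zify.

Set Implicit Arguments.
Unset Strict Implicit.
Unset Printing Implicit Defensive.

Import GRing.Theory.
Local Open Scope ring_scope.

(* A formal power series is the sequence of its coefficients. *)
Definition fps (R : Type) := nat -> R.

Section FormalPowerSeries.
Variable R : fieldType.
Implicit Types f g : fps R.

Definition fps_one : fps R := fun n => (n == 0%N)%:R.
Definition fps_X : fps R := fun n => (n == 1%N)%:R.
Definition fps_opp f : fps R := fun n => - f n.
Definition fps_sub f g : fps R := fun n => f n - g n.
Definition fps_mul f g : fps R := fun n => \sum_(i < n.+1) f i * g (n - i)%N.
Definition fps_exp f k : fps R := iter k (fps_mul f) fps_one.

(* Substitution f(g(t)), meaningful when g has zero constant term: g ^ k then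
   has order at least k (fps_exp_order), so only the powers k <= n contribute
   to the coefficient of t ^ n. *)
Definition fps_comp f g : fps R := fun n => \sum_(k < n.+1) f k * fps_exp g k n.

(* 1 / (1 - t); see fps_geomP. *)
Definition fps_geom : fps R := fun=> 1.

Lemma fps_exp_order g k n : g 0%N = 0 -> (n < k)%N -> fps_exp g k n = 0.
Proof.
move=> g0; elim: k n => // k IHk n ltnk.
rewrite /fps_exp iterS -/(fps_exp g k) /fps_mul big1 // => i _.
have [->|i_gt0] := posnP i; first by rewrite g0 mul0r.
by rewrite IHk ?mulr0 //; have := ltn_ord i; lia.
Qed.

Lemma fps_geomP : fps_mul (fps_sub fps_one fps_X) fps_geom =1 fps_one.
Proof.
move=> n; rewrite /fps_mul /fps_sub /fps_one /fps_X /fps_geom.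
case: n => [|n]; first by rewrite big_ord1 subr0 mulr1.
rewrite big_ord_recl big_ord_recl big1 => [|i _] /=.
  by rewrite !mulr1 subr0 sub0r addr0 addrN.
by rewrite subrr mul0r.
Qed.

Definition gbinom (x : R) (k : nat) : R :=
  (\prod_(i < k) (x - i%:R)) / k`!%:R.

Definition degenerate_polylog (m : int) (mu : R) : fps R := fun n =>
  if n == 0%N then 0
  else (-1) ^+ n.-1 / (n%:R ^ m) * gbinom (mu - 1) n.-1.

(* Generating series -1/(1-t) Li_{m,-lambda}(-t/(1-t)). *)
Definition deg_K_series (m : nat) (lambda : R) : fps R :=
  fps_mul (fps_opp fps_geom)
    (fps_comp (degenerate_polylog m%:Z (- lambda))
              (fps_mul (fps_opp fps_X) fps_geom)).

(* deg_K n m lambda is the number K_{n,lambda}^{(m)}, for n >= 1; the series has no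
   constant term (deg_K_series0). *)
Definition deg_K (n m : nat) (lambda : R) : R := deg_K_series m lambda n.

Lemma deg_K_series0 m lambda : deg_K_series m lambda 0%N = 0.
Proof.
by rewrite /deg_K_series /fps_mul big_ord1 /fps_comp big_ord1 mul0r mulr0.
Qed.

End FormalPowerSeries.

(* Main.v *)
(** Since [(-t/(1-t))^k / (1-t)] has coefficients [(-1)^k 'C(n, k)], the number
   K_n^(m) is the weighted binomial transform
   [T_m(n) = \sum_(1 <= k <= n) 'C(n, k) gbinom(-lambda-1, k-1) / k^m].
   The absorption identity [n ('C(n, k) - 'C(n-1, k)) = k 'C(n, k)] gives
   [T_m(n) - T_m(n-1) = T_(m-1)(n) / n], so [T_m] is an m-fold iterated sum of
   [T_0], which is exactly the shape of the sum over chains k_1 <= ... <= k_m <= n.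
   The base case [T_0(n) = (-1)^(n-1) gbinom(lambda-1, n-1)] is Vandermonde's identity. *)
Require Import Defs.
From mathcomp Require Import all_boot all_order all_algebra.
From mathcomp Require Import reals ring.

Set Implicit Arguments.
Unset Strict Implicit.
Unset Printing Implicit Defensive.

Import GRing.Theory Num.Theory.
Local Open Scope ring_scope.

Section SeriesCoefficients.
Variable F : fieldType.
Implicit Types f : fps F.

Lemma fps_mulC f g : fps_mul f g =1 fps_mul g f.
Proof.
move=> n; rewrite /fps_mul (reindex_inj rev_ord_inj); apply: eq_bigr => i _ /=.
by rewrite mulrC subSS subKn // -ltnS.
Qed.

Lemma fps_mul_geomE f n : fps_mul f (fps_geom F) n = \sum_(i < n.+1) f i.
Proof. by apply: eq_bigr => i _; rewrite mulr1. Qed.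

Local Notation g := (fps_mul (fps_opp (fps_X F)) (fps_geom F)).

Lemma mobius_series0 : g 0%N = 0.
Proof. by rewrite fps_mul_geomE big_ord1 /fps_opp /fps_X oppr0. Qed.

Lemma mobius_seriesS n : g n.+1 = -1.
Proof.
rewrite fps_mul_geomE !big_ord_recl big1 => [|i _]; rewrite /fps_opp /fps_X /= oppr0 //.
by rewrite add0r addr0.
Qed.

(** Multiplication by [g], with coefficients 0, -1, -1, ..., shifts by one and negates partial
    sums. *)
Lemma fps_expS_mobius k n :
  fps_exp g k.+1 n.+1 = - \sum_(j < n.+1) fps_exp g k j.
Proof.
rewrite /fps_exp iterS -/(fps_exp g k) fps_mulC.
transitivity (\sum_(i < n.+2) fps_exp g k i * g (n.+1 - i)%N) => //.
rewrite big_ord_recr /= subnn mobius_series0 mulr0 addr0 -sumrN; apply: eq_bigr => i _.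
have le_in : (i <= n)%N by rewrite -ltnS.
by rewrite subSn // mobius_seriesS mulrN1.
Qed.

(** These partial sums are the coefficients of [g ^ k / (1 - t)]; by [fps_expS_mobius] they obey
    Pascal's rule up to sign. *)
Lemma sum_fps_exp_mobius k n :
  \sum_(j < n.+1) fps_exp g k j = (-1) ^+ k * 'C(n, k)%:R.
Proof.
elim: k n => [|k IHk] n.
  rewrite big_ord_recl big1 => [|i _]; rewrite /fps_exp /fps_one //=.
  by rewrite addr0 bin0 mulr1.
elim: n => [|n IHn].
  by rewrite big_ord1 fps_exp_order ?mobius_series0 // bin0n mulr0.
set e := fps_exp g k.+1 in IHn *.
rewrite big_ord_recr /= IHn /e fps_expS_mobius IHk binS natrD exprS; ring.
Qed.

Lemma fps_geom_comp_mobius f n :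
  fps_mul (fps_opp (fps_geom F)) (fps_comp f g) n =
  - \sum_(k < n.+1) f k * ((-1) ^+ k * 'C(n, k)%:R).
Proof.
transitivity (- \sum_(j < n.+1) fps_comp f g j).
  rewrite fps_mulC -sumrN; apply: eq_bigr => i _.
  by rewrite /fps_opp /fps_geom mulrN1.
congr (- _).
transitivity (\sum_(j < n.+1) \sum_(k < n.+1) f k * fps_exp g k j).
  apply: eq_bigr => j _; rewrite /fps_comp.
  (* The range of [k] can be made independent of [j], as [g ^ k] has order at least [k]; the two
     sums then commute. *)
  rewrite (big_ord_widen n.+1 (fun k => f k * fps_exp g k j)) //.
  rewrite big_mkcond; apply: eq_bigr => k _; case: ltnP => // lt_jk.
  by rewrite fps_exp_order ?mobius_series0 // mulr0.
rewrite exchange_big; apply: eq_bigr => k _.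
by rewrite -mulr_sumr sum_fps_exp_mobius.
Qed.

End SeriesCoefficients.

Section PascalFamilies.
Variable F : numFieldType.
Implicit Types x : F.

Lemma gbinom0 x : gbinom x 0 = 1.
Proof. by rewrite /gbinom big_ord0 divr1. Qed.

Lemma gbinom_pascal x k : gbinom x k + gbinom x k.+1 = gbinom (x + 1) k.+1.
Proof.
rewrite /gbinom big_ord_recr [in RHS]big_ord_recl /=.
have bump_sub i : x + 1 - (bump 0 i)%:R = x - i%:R.
  by rewrite /bump leq0n add1n -nat1r; ring.
under [in RHS]eq_bigr => i _ do rewrite bump_sub.
rewrite factS natrM -natr1.
have k1_neq0 : k%:R + 1 != 0 :> F by rewrite natr1 pnatr_eq0.
have kf_neq0 : k`!%:R != 0 :> F by rewrite pnatr_eq0 -lt0n fact_gt0.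
by field; rewrite kf_neq0.
Qed.

(** Vandermonde's identity for any family obeying Pascal's rule: [P (x + n) n] is expanded by [n]
    uses of the rule. [P] varies in the induction, which passes to the family shifted in [k]. *)
Lemma sum_bin_pascal (P : F -> nat -> F) x n :
  (forall y k, P y k + P y k.+1 = P (y + 1) k.+1) ->
  \sum_(k < n.+1) 'C(n, k)%:R * P x k = P (x + n%:R) n.
Proof.
elim: n P x => [|n IHn] P x pascalP; first by rewrite big_ord1 mul1r addr0.
rewrite -nat1r addrA -(IHn (fun y k => P y k.+1)) => [|y k]; last exact: pascalP.
under [RHS]eq_bigr => k _ do rewrite -pascalP mulrDr.
rewrite big_split /= big_ord_recl bin0.
under [in LHS]eq_bigr => k _ do rewrite lift0 binS natrD mulrDl.
rewrite big_split /= addrA; congr (_ + _).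
rewrite big_ord_recr /= bin_small // mul0r addr0 [in RHS]big_ord_recl bin0.
by congr (_ + _); apply: eq_bigr.
Qed.

(** The value 0 at [k = 0] keeps Pascal's rule valid there. *)
Definition shifted_gbinom x k := if k is j.+1 then gbinom x j else 0.

Lemma shifted_gbinom_pascal x k :
  shifted_gbinom x k + shifted_gbinom x k.+1 = shifted_gbinom (x + 1) k.+1.
Proof. by case: k => [|k] /=; rewrite ?gbinom0 ?add0r // gbinom_pascal. Qed.

(** Upper negation: once the product is reversed, its factors are [- (x - 1 - i)]. *)
Lemma gbinom_neg x k : gbinom (- x + k%:R) k = (-1) ^+ k * gbinom (x - 1) k.
Proof.
rewrite /gbinom mulrA; congr (_ / _).
rewrite -[k in (-1) ^+ k]card_ord -prodr_const -big_split /=.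
rewrite (reindex_inj rev_ord_inj); apply: eq_bigr => i _ /=.
by rewrite natrB // -natr1; ring.
Qed.

End PascalFamilies.

Section IteratedSums.
Variable F : numFieldType.
Implicit Type a : nat -> F.

Definition bin_power_sum a m n := \sum_(k < n.+1) 'C(n, k)%:R * a k / k%:R ^+ m.

Lemma bin_power_sumS a m n : a 0%N = 0 ->
  bin_power_sum a m.+1 n.+1 =
  bin_power_sum a m.+1 n + n.+1%:R^-1 * bin_power_sum a m n.+1.
Proof.
move=> a0; rewrite /bin_power_sum.
(* Padding with the null term ['C(n, n.+1)] gives all sums the same range, so they compare
   termwise. *)
rewrite [X in _ = X + _](_ : _ =
    \sum_(k < n.+2) 'C(n, k)%:R * a k / k%:R ^+ m.+1); last first.
  by rewrite [RHS]big_ord_recr /= bin_small // !mul0r addr0.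
rewrite mulr_sumr -big_split; apply: eq_bigr => -[[|k] _] _ /=.
  by rewrite a0 !mulr0 !mul0r mulr0 addr0.
have k1_neq0 : k.+1%:R != 0 :> F by rewrite pnatr_eq0.
have n1_neq0 : n.+1%:R != 0 :> F by rewrite pnatr_eq0.
have absorb : 'C(n.+1, k.+1)%:R = n.+1%:R * 'C(n, k)%:R / k.+1%:R :> F.
  by apply: canRL (mulfK k1_neq0) _; rewrite mulrC -!natrM mul_bin_diag.
rewrite [X in _ = _ + X](_ : _ = 'C(n, k)%:R * a k.+1 / k.+1%:R ^+ m.+1).
  by rewrite binS natrD; ring.
by rewrite absorb exprS; field; rewrite !nat1r expf_neq0 ?k1_neq0.
Qed.

Lemma bin_power_sum_rec a m n : a 0%N = 0 ->
  bin_power_sum a m.+1 n = \sum_(y < n.+1) y%:R^-1 * bin_power_sum a m y.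
Proof.
move=> a0; elim: n => [|n IHn].
  by rewrite big_ord1 /bin_power_sum big_ord1 a0 mulr0 !mul0r invr0 mul0r.
by rewrite big_ord_recr /= -IHn bin_power_sumS.
Qed.

Lemma rcons_tuple_bij (T : finType) m :
  bijective (fun p : T * m.-tuple T => [tuple of rcons p.2 p.1]).
Proof.
apply: inj_card_bij => [[x s] [y t] /= /(congr1 val) /= /rcons_inj [st ->]|].
  by rewrite (val_inj st).
by rewrite card_prod !card_tuple expnS.
Qed.

(* The bound [b] also serves as default for the first index, so that adding a
   last index [y] to a chain turns the bound [b] into [y], even for empty chains. *)
Definition chain_sum (c : nat -> F) N m b : F :=
  \sum_(k : m.-tuple 'I_N.+1 |
        path leq 1%N (map val k) && (last 1%N (map val k) <= b)%N)
    c (head b (map val k)) / \prod_(i <- map val k) i%:R.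

(** The last index [y] is split off and bounds the rest of the chain; [N] stays fixed so that the
    entries keep their type. *)
Lemma chain_sum_rec c N m b : (b <= N)%N ->
  chain_sum c N m.+1 b = \sum_(y < b.+1) y%:R^-1 * chain_sum c N m y.
Proof.
move=> le_bN; rewrite (big_ord_widen N.+1 (fun y => y%:R^-1 * chain_sum c N m y)) //.
rewrite /chain_sum (reindex _ (onW_bij _ (rcons_tuple_bij _ m))) /=.
under [RHS]eq_bigr => y _ do rewrite mulr_sumr.
rewrite pair_big_dep /=; apply: eq_big => [[y s]|[y s] _] /=.
  by rewrite map_rcons rcons_path last_rcons andbC.
rewrite map_rcons headI /= -headI big_rcons /=.
by rewrite invfM; case: (map _ _) => [|? ?] /=; ring.
Qed.

Lemma chain_sumE a c N m b : a 0%N = 0 ->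
  (forall n, (0 < n)%N -> bin_power_sum a 0 n = c n) -> (b <= N)%N -> (0 < b)%N ->
  bin_power_sum a m b = chain_sum c N m b.
Proof.
move=> a0 base; elim: m b => [|m IHm] b le_bN b_gt0.
  rewrite base // /chain_sum (big_pred1 [tuple]) => [|k]; last first.
    by rewrite tuple0 /= b_gt0 eqxx.
  by rewrite big_nil divr1.
rewrite bin_power_sum_rec // chain_sum_rec //; apply: eq_bigr => -[[|y] lt_yb] _ /=.
  (* The term [y = 0], outside the induction hypothesis, vanishes because [0^-1 = 0]. *)
  by rewrite invr0 !mul0r.
by rewrite IHm // (leq_trans _ le_bN).
Qed.

End IteratedSums.

Lemma deg_K_bin_power_sum (R : numFieldType) (lambda : R) n m :
  deg_K n m lambda = bin_power_sum (shifted_gbinom (- lambda - 1)) m n.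
Proof.
rewrite /deg_K /deg_K_series fps_geom_comp_mobius -sumrN.
apply: eq_bigr => -[[|k] _] _ /=.
  by rewrite /degenerate_polylog /= !(mul0r, mulr0, oppr0).
rewrite /degenerate_polylog /= -exprnP exprS.
(* The sign of the polylogarithm cancels that of the substitution and the outer minus. *)
have sgn : (-1) ^+ k * (-1) ^+ k = 1 :> R by rewrite -expr2 sqrr_sign.
rewrite -[RHS]mul1r -[X in _ = X * _]sgn; ring.
Qed.

Lemma bin_power_sum0_gbinom (R : numFieldType) (lambda : R) n : (0 < n)%N ->
  bin_power_sum (shifted_gbinom (- lambda - 1)) 0 n =
  (-1) ^+ n.-1 * gbinom (lambda - 1) n.-1.
Proof.
case: n => // n _; rewrite /bin_power_sum.
under eq_bigr => k _ do rewrite expr0 divr1.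
rewrite sum_bin_pascal /=; last exact: shifted_gbinom_pascal.
by rewrite -gbinom_neg -natr1; congr gbinom; ring.
Qed.

Theorem theorem2p7 (R : realType) (lambda : R) (lambda_neq0 : lambda != 0)
    (n m : nat) (n_gt0 : (0 < n)%N) (m_gt0 : (0 < m)%N) :
  deg_K n m lambda =
    \sum_(k : m.-tuple 'I_n.+1 | path leq 1%N [seq val i | i <- k])
      (-1) ^+ (tnth k (Ordinal m_gt0)).-1 / (\prod_(i < m) (tnth k i)%:R)
        * gbinom (lambda - 1) (tnth k (Ordinal m_gt0)).-1.
Proof.
rewrite deg_K_bin_power_sum.
rewrite (chain_sumE (c := fun j => (-1) ^+ j.-1 * gbinom (lambda - 1) j.-1)
  (N := n)) //; last exact: bin_power_sum0_gbinom.
apply: eq_big => [k|k _].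
  (* The bound [n] on the last index is automatic for entries in ['I_n.+1]. *)
  rewrite andb_idr // => _; apply: (@leq_trans (last 1%N (map val k))) => //.
  case: m {m_gt0} k => [|m] k; first by rewrite tuple0.
  by case/tupleP: k => x k /=; rewrite last_map -ltnS.
rewrite big_map big_tuple; case: m m_gt0 k => // m m_gt0 k.
rewrite (_ : tnth k (Ordinal m_gt0) = thead k); last by congr tnth; apply: val_inj.
by case/tupleP: k => x k; rewrite theadE /=; ring.
Qed.
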